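(* Let $d\ge1$ and let $f\in R_d=\mathbb{Z}[u_1^{\pm1},\dots,u_d^{\pm1}]$ be a nonzero irreducible Laurent polynomial. For every $\varepsilon>0$ and every $\psi\colon\mathbb{Z}_+\to\mathbb{Z}_+$ with $\psi(n)\to\infty$ as $n\to\infty$, there is an $L\ge1$ such that for every finite-index subgroup $\Gamma\subset\mathbb{Z}^d$ with $\langle\Gamma\rangle>L$ and every $\boldsymbol\omega\in\Omega_\Gamma\smallsetminus\mathsf U(f)$ we have $$\operatorname{dist}(\boldsymbol\omega,\mathsf U(f))\ge e^{-\varepsilon\,\psi(\langle\Gamma\rangle)\,|\Omega_\Gamma|}.$$
   Context: $\mathbb{Z}_+=\{0,1,2,\dots\}$; $\mathbb{S}=\{z\in\mathbb{C}:|z|=1\}$; $\mathsf U(f)=\{\mathbf z\in\mathbb{S}^d:f(\mathbf z)=0\}$; $\operatorname{dist}$ is the usual distance on $\mathbb{S}^d$, with distance to the empty set taken to be $+\infty$. For a finite-index subgroup $\Gamma\subset\mathbb{Z}^d$, $\langle\Gamma\rangle=\min\{\|\mathbf m\|:\mathbf 0\ne\mathbf m\in\Gamma\}$ with $\|\mathbf m\|=\max_j|m_j|$, and $\Omega_\Gamma=\{\boldsymbol\omega\in\mathbb{S}^d:\boldsymbol\omega^{\mathbf m}=1\text{ for all }\mathbf m\in\Gamma\}$, where $\boldsymbol\omega^{\mathbf m}=\omega_1^{m_1}\cdots\omega_d^{m_d}$; it has cardinality $|\mathbb{Z}^d/\Gamma|$. Irreducible means irreducible in the ring $R_d$, whose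 units are $\pm u_1^{n_1}\cdots u_d^{n_d}$. *)

(* Defs.v *)
From HB Require Import structures.
From mathcomp Require Import all_boot all_order all_algebra.
From mathcomp Require Import finmap complex monalg.
From mathcomp Require Import all_classical all_reals all_analysis.

Set Implicit Arguments.
Unset Strict Implicit.
Unset Printing Implicit Defensive.

Import Order.TTheory GRing.Theory Num.Theory.

Local Open Scope classical_set_scope.
Local Open Scope ring_scope.

(* Z[u_1^{+-1}, ..., u_d^{+-1}] as the group ring of Z^d: f is stored as its
   finitely supported coefficient function, f@_m being the coefficient of u^m.
   The library's product on {malg R[K]} does not apply, because it requires a
   monoid K of exponents without nontrivial invertible elements. *)
Definition laurent (d : nat) : Type := {malg int['rV[int]_d]}.

HB.instance Definition _ (d : nat) := GRing.Zmodule.on (laurent d).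

Lemma biadditive_assoc (V : zmodType) (mul : V -> V -> V) (B : V -> Prop) :
  (forall P : V -> Prop, P 0 -> (forall f g, P f -> P g -> P (f + g)) ->
    (forall f, B f -> P f) -> forall f, P f) ->
  left_zero 0 mul -> right_zero 0 mul ->
  left_distributive mul +%R -> right_distributive mul +%R ->
  (forall f g h, B f -> B g -> B h ->
    mul f (mul g h) = mul (mul f g) h) ->
  associative mul.
Proof.
move=> indB mul0l mul0r mulDl mulDr mulBA f g h.
elim/indB: f => [|f f' IH IH'|f Bf]; first by rewrite !mul0l.
  by rewrite !mulDl IH IH'.
elim/indB: g => [|g g' IH IH'|g Bg]; first by rewrite mul0l mul0r mul0l.
  by rewrite mulDl !mulDr mulDl IH IH'.
elim/indB: h => [|h h' IH IH'|h Bh]; first by rewrite !mul0r.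
  by rewrite !mulDr IH IH'.
exact: mulBA.
Qed.

Section LaurentRing.
Variable d : nat.
Implicit Types f g h : laurent d.

Definition laurent_one : laurent d := << 1 *g 0 >>.

Definition laurent_mul f g : laurent d :=
  \sum_(m <- msupp f) \sum_(n <- msupp g) << f@_m * g@_n *g m + n >>.

Local Open Scope fset_scope.
Local Open Scope ring_scope.

Lemma laurent_mulw (A B : {fset 'rV[int]_d}) f g :
  msupp f `<=` A -> msupp g `<=` B ->
  laurent_mul f g =
  \sum_(m <- A) \sum_(n <- B) (<< f@_m * g@_n *g m + n >> : laurent d).
Proof.
move=> fA gB; rewrite /laurent_mul (big_fset_incl _ fA) /=.
  apply: eq_bigr => m _; apply: big_fset_incl => // n _ /mcoeff_outdom ->.
  by rewrite mulr0 monalgU0.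
move=> m _ /mcoeff_outdom fm.
by rewrite big1 // => n _; rewrite fm mul0r monalgU0.
Qed.

Lemma laurent_mulC : commutative laurent_mul.
Proof.
move=> f g; rewrite /laurent_mul exchange_big.
by apply: eq_bigr => n _; apply: eq_bigr => m _; rewrite mulrC addrC.
Qed.

Lemma laurent_mul0 : left_zero 0 laurent_mul.
Proof. by move=> g; rewrite /laurent_mul msupp0 big_seq_fset0. Qed.

Lemma laurent_mulU a m g :
  laurent_mul << a *g m >> g =
  \sum_(n <- msupp g) (<< a * g@_n *g m + n >> : laurent d).
Proof.
rewrite (laurent_mulw msuppU_le (fsubset_refl _)) big_seq_fset1.
by apply: eq_bigr => n _; rewrite mcoeffUU.
Qed.

Lemma laurent_mulUU a b m n :
  laurent_mul << a *g m >> << b *g n >> = << a * b *g m + n >>.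
Proof.
by rewrite (laurent_mulw msuppU_le msuppU_le) !big_seq_fset1 !mcoeffUU.
Qed.

Lemma laurent_mul1 : left_id laurent_one laurent_mul.
Proof.
move=> g; rewrite laurent_mulU [RHS]monalgE.
by apply: eq_bigr => n _; rewrite mul1r add0r.
Qed.

Lemma laurent_mulDl : left_distributive laurent_mul +%R.
Proof.
move=> f g h.
rewrite [in RHS](laurent_mulw (fsubsetUl _ (msupp g)) (fsubset_refl _)).
rewrite [in RHS](laurent_mulw (fsubsetUr (msupp f) _) (fsubset_refl _)).
rewrite (laurent_mulw (msuppD_le _ _) (fsubset_refl _)).
rewrite -big_split /=; apply: eq_bigr => m _.
rewrite -big_split /=; apply: eq_bigr => n _.
by rewrite mcoeffD mulrDl monalgUD.
Qed.

Lemma laurent_mulA : associative laurent_mul.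
Proof.
pose basis (f : laurent d) := exists a m, f = << a *g m >>.
apply: (@biadditive_assoc _ laurent_mul basis).
- move=> P P0 PD PU f; rewrite [f]monalgE.
  by apply: (big_ind P) => // m _; apply: PU; exists f@_m, m.
- exact: laurent_mul0.
- by move=> f; rewrite laurent_mulC laurent_mul0.
- exact: laurent_mulDl.
- by move=> f g h; rewrite ![laurent_mul f _]laurent_mulC laurent_mulDl.
- move=> _ _ _ [a [m ->]] [b [n ->]] [c [p ->]].
  rewrite (laurent_mulUU b c) (laurent_mulUU a b).
  by rewrite (laurent_mulUU a) (laurent_mulUU (a * b)) mulrA addrA.
Qed.

Lemma laurent_one_neq0 : laurent_one != 0.
Proof. by rewrite monalgU_eq0 oner_eq0. Qed.

HB.instance Definition _ := GRing.Zmodule_isComNzRing.Build (laurent d)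
  laurent_mulA laurent_mulC laurent_mul1 laurent_mulDl laurent_one_neq0.

End LaurentRing.

Definition is_unit (A : comNzRingType) (a : A) : Prop := exists b, a * b = 1.

Definition irreducible (A : comNzRingType) (a : A) : Prop :=
  [/\ a != 0, ~ is_unit a &
      forall b c : A, a = b * c -> is_unit b \/ is_unit c].

Section Torus.
Variables (R : realType) (d : nat).
Implicit Types (z w : 'rV[R[i]]_d) (m : 'rV[int]_d) (A : set 'rV[R[i]]_d).

Definition torus : set 'rV[R[i]]_d := [set z | forall j, `|z 0 j| = 1].

Definition monomial_eval z m : R[i] := \prod_(j < d) z 0 j ^ m 0 j.

Definition laurent_eval (f : laurent d) z : R[i] :=
  \sum_(m <- msupp f) (f@_m)%:~R * monomial_eval z m.

Definition unitary_variety (f : laurent d) : set 'rV[R[i]]_d :=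
  [set z | torus z /\ laurent_eval f z = 0].

(* The Euclidean distance of C^d = R^(2d). *)
Definition torus_dist z w : R :=
  Num.sqrt (\sum_(j < d) (complex.Re `|z 0 j - w 0 j|) ^+ 2).

(* The infimum of the empty set is +oo. *)
Definition dist_to z A : \bar R :=
  ereal_inf [set (torus_dist z w)%:E | w in A].

End Torus.

Section Subgroups.
Variable d : nat.

Definition finite_index (G : zmodClosed 'rV[int]_d) : Prop :=
  finite_set (range (fun x : 'rV[int]_d => [set y | y - x \in G])).

Definition max_norm (m : 'rV[int]_d) : nat := \max_(j < d) `|m 0%R j|.

(* The junk value 0 is only taken when G has no nonzero element. *)
Definition min_norm (G : zmodClosed 'rV[int]_d) : nat :=
  xget 0%N [set k | (exists m, [/\ m \in G, m != 0 & max_norm m = k]) /\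
                    (forall m, m \in G -> m != 0 -> (k <= max_norm m)%N)].

Definition annihilator (R : realType) (G : zmodClosed 'rV[int]_d) :
    set 'rV[R[i]]_d :=
  [set w | torus w /\ (forall m, m \in G -> monomial_eval w m = 1)].

(* As fset_set is the empty set on infinite sets, this is the cardinality only
   when the annihilator is finite, which holds if G has finite index. *)
Definition annihilator_card (R : realType) (G : zmodClosed 'rV[int]_d) : nat :=
  #|` fset_set (annihilator G : set 'rV[R[i]]_d)|%fset.

End Subgroups.

(* Main.v *)
(* Let w be in the annihilator of a finite-index subgroup. By pigeonhole among
   its powers, w^n = 1 for some 0 < n <= |Omega|. Multiplication by f(w) maps
   the integer combinations of the n-th roots of unity to themselves, so f(w) is
   an eigenvalue of an n x n integer matrix all of whose eigenvalues are bounded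
   by the l^1 norm |f| of the coefficients. The product of its nonzero
   eigenvalues is, up to sign, a coefficient of its characteristic polynomial,
   hence a nonzero integer, so |f(w)| >= |f|^-n when f(w) <> 0. As f is Lipschitz
   on the torus, dist(w, U(f)) >= C^-|Omega| with C depending only on f, and
   C <= exp(eps psi(<Gamma>)) as soon as <Gamma> is large. *)

Require Import Defs.
From mathcomp Require Import all_boot all_order all_algebra.
From mathcomp Require Import finmap complex monalg.
From mathcomp Require Import all_classical all_reals all_analysis.

Set Implicit Arguments.
Unset Strict Implicit.
Unset Printing Implicit Defensive.

Import Order.TTheory GRing.Theory Num.Theory.

Local Open Scope classical_set_scope.
Local Open Scope ring_scope.

(** * Eigenvalue bounds, roots of integer polynomials and pigeonhole *)

(** Compare the [j]-th entries of [v A = a v], where [|v_j|] is maximal. Eigenvectors are rows here,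
    so it is the column sums of [A] that matter. *)
Lemma eigenvalue_norm_le (F : numFieldType) (n : nat) (A : 'M[F]_n) (C a : F) :
  (forall j, \sum_i `|A i j| <= C) -> eigenvalue A a -> `|a| <= C.
Proof.
move=> AC /eigenvalueP[v vA /rV0Pn[i0 vi0]].
have [j _ maxj] := @real_arg_maxP F 'I_n i0 xpredT (fun i => `|v 0 i|) isT
  (fun i _ => normr_real (v 0 i)).
have vj : 0 < `|v 0 j|.
  by apply: lt_le_trans _ (maxj i0 isT); rewrite normr_gt0.
rewrite -(ler_pM2r vj) -normrM.
have := congr1 (fun u : 'rV_n => u 0 j) vA; rewrite !mxE => <-.
apply: le_trans (ler_norm_sum _ _ _) _.
apply: (@le_trans _ _ ((\sum_i `|A i j|) * `|v 0 j|)); last first.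
  by rewrite ler_wpM2r ?AC ?ltW.
rewrite mulr_suml.
apply: ler_sum => i _; rewrite normrM mulrC ler_wpM2l ?normr_ge0 //.
exact: maxj.
Qed.

(** Write [p = q X^k] with [q(0) != 0]. Then [q(0)] is a nonzero integer and, up to sign, the
    product of the roots of [q]. One of these is [a]; the others have modulus at most [C]. *)
Lemma monic_int_root_ge (F : numClosedFieldType) (p : {poly int}) (C a : F) :
  p \is monic -> 1 <= C ->
  (forall x, root (map_poly intr p) x -> `|x| <= C) ->
  root (map_poly intr p) a -> a != 0 -> 1 <= C ^+ (size p).-1 * `|a|.
Proof.
move=> p_monic C1 rootC pa a0.
have p0 := monic_neq0 p_monic.
have [k [q /implyP/(_ p0) q0 pE]] := multiplicity_XsubC p 0.
have X_monic : ('X - (0 : int)%:P) ^+ k \is monic.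
  by rewrite monic_exp ?monicXsubC.
have q_monic : q \is monic by rewrite -(monicMr _ X_monic) -pE.
have pqE : map_poly intr p = map_poly intr q * 'X ^+ k :> {poly F}.
  by rewrite pE rmorphM rmorphXn /= rmorphB /= map_polyX map_polyC /= subr0.
have szqp : (size q <= size p)%N.
  rewrite pE size_Mmonic ?monic_neq0 // -ltnS.
  have : (0 < size (('X - (0 : int)%:P) ^+ k)%R)%N.
    by rewrite size_poly_gt0 monic_neq0.
  case: (size (('X - (0 : int)%:P) ^+ k)%R) => // s _.
  by rewrite addnS /= ltnS leq_addr.
have qa : root (map_poly intr q) a.
  by move: pa; rewrite pqE /root hornerM hornerXn mulf_eq0 expf_eq0 (negPf a0)
     andbF orbF.
have [rs] := closed_field_poly_normal (map_poly intr q : {poly F}).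
rewrite (monicP (monic_map _ q_monic)) scale1r => qE.
have ars : a \in rs by rewrite -root_prod_XsubC -qE.
have rsC r : r \in rs -> `|r| <= C.
  by rewrite -root_prod_XsubC -qE => rr; rewrite rootC // pqE rootM rr.
have q0_ge1 : 1 <= `|(map_poly intr q : {poly F}).[0]|.
  rewrite -(rmorph0 (intr : int -> F)) horner_map /= -intr_norm ler1z.
  by rewrite -gtz0_ge1 normr_gt0.
apply: le_trans q0_ge1 _; rewrite qE horner_prod normr_prod.
under eq_bigr do rewrite hornerXsubC sub0r normrN.
rewrite (big_rem a) //= mulrC ler_wpM2r //.
have prod_le s : {subset s <= rs} -> \prod_(y <- s) `|y| <= C ^+ size s.
  elim: s => [|r s IH] srs; first by rewrite big_nil.
  rewrite big_cons exprS ler_pM ?prodr_ge0 //.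
    by rewrite rsC ?srs ?mem_head.
  by apply: IH => x xs; rewrite srs ?inE ?xs ?orbT.
apply: le_trans (prod_le _ (mem_subseq (rem_subseq a rs))) _.
(* There are no more remaining roots than the degree of [p], and [1 <= C] allows the exponent to be
   raised to it. *)
rewrite ler_weXn2l // size_rem //; apply: leq_trans (leq_pred _) _.
rewrite -ltnS prednK ?size_poly_gt0 //; apply: leq_trans szqp.
by rewrite -(size_prod_XsubC rs id) -qE size_map_poly_id0 // (monicP q_monic).
Qed.

Lemma finite_set_pigeonhole (T : choiceType) (A : set T) (u : nat -> T) :
  finite_set A -> (forall k, A (u k)) ->
  exists i j, [/\ (i < j)%N, (j <= #|` fset_set A|)%N & u i = u j].
Proof.
move=> finA Au; set n := #|` fset_set A|%fset.
have uA k : u k \in fset_set A by rewrite in_fset_set // inE.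
(* The [n + 1] indices [0, ..., n] are sent to [n] elements; stopping at [n] gives the bound on
   [j]. *)
pose v (k : 'I_n.+1) : fset_set A := [` uA k]%fset.
have /injectivePn[i [j nij /(congr1 val)/= uij]] : ~~ injectiveb v.
  by apply/negP => /injectiveP/leq_card; rewrite card_ord -cardfE ltnn.
have : val i != val j by [].
rewrite neq_ltn => /orP[ij|ij]; [exists i, j | exists j, i];
  by split => //; rewrite -ltnS.
Qed.

(** * Lipschitz estimates for monomials on the unit circle *)

(** Telescoping: the factors are exchanged one at a time, and the untouched ones have modulus 1. *)
Lemma normr_prodB_le (F : numFieldType) (I : Type) (r : seq I) (a b : I -> F) :
  (forall i, `|a i| = 1) -> (forall i, `|b i| = 1) ->
  `|\prod_(i <- r) a i - \prod_(i <- r) b i| <= \sum_(i <- r) `|a i - b i|.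
Proof.
move=> a1 b1; elim: r => [|i r IH]; first by rewrite !big_nil subrr normr0.
rewrite !big_cons; set x := \prod_(j <- r) a j; set y := \prod_(j <- r) b j.
have -> : a i * x - b i * y = (a i - b i) * x + b i * (x - y).
  by rewrite mulrBl mulrBr addrA subrK.
apply: le_trans (ler_normD _ _) _; rewrite !normrM b1 mul1r lerD //.
by rewrite /x normr_prod big1 ?mulr1.
Qed.

Lemma normr_exprz_unit (F : numFieldType) (a : F) (n : int) :
  `|a| = 1 -> `|a ^ n| = 1.
Proof.
by move=> a1; case: n => k; rewrite /exprz ?normfV normrX a1 expr1n ?invr1.
Qed.

Lemma normr_exprzB_le (F : numFieldType) (a b : F) (n : int) :
  `|a| = 1 -> `|b| = 1 -> `|a ^ n - b ^ n| <= `|n|%N%:R * `|a - b|.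
Proof.
move=> a1 b1.
have expr_le k : `|a ^+ k - b ^+ k| <= k%:R * `|a - b|.
  rewrite -[k]subn0 -!prodr_const_nat.
  apply: le_trans (normr_prodB_le _ _ _) _ => //.
  by rewrite sumr_const_nat mulr_natl.
have unit_neq0 (c : F) k : `|c| = 1 -> c ^+ k != 0.
  by move=> c1; rewrite expf_neq0 // -normr_eq0 c1 oner_neq0.
case: n => k; first exact: expr_le.
(* [Negz k] stands for [-(k + 1)]. Over the common denominator, which has modulus 1, the difference
   reduces to that of positive powers. *)
have -> : a ^ Negz k - b ^ Negz k
    = (b ^+ k.+1 - a ^+ k.+1) / (a ^+ k.+1 * b ^+ k.+1).
  rewrite mulrBl invfM mulrCA divff ?unit_neq0 // mulrA divff ?unit_neq0 //.
  by rewrite mulr1 mul1r.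
by rewrite normrM normfV normrM !normrX a1 b1 !expr1n mulr1 invr1 mulr1 distrC.
Qed.

(** * Upper and lower bounds for the values of a Laurent polynomial on the torus *)

Section LaurentBounds.
Variable d : nat.
Implicit Types (f : laurent d) (m : 'rV[int]_d).

Definition laurent_norm f : nat := (\sum_(m <- msupp f) `|f@_m|)%N.

(** A Lipschitz constant of [f] on the torus: the monomial with exponent [m] contributes the l^1
    norm of [m]. *)
Definition laurent_lip f : nat :=
  (\sum_(m <- msupp f) `|f@_m| * \sum_(j < d) `|m 0%R j|)%N.

Lemma laurent_norm_gt0 f : f != 0 -> (0 < laurent_norm f)%N.
Proof.
move=> f0; have /fset0Pn[m mf] : msupp f != fset0.
  by apply: contraNneq f0 => f0; rewrite [f]monalgE f0 big_seq_fset0.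
by rewrite /laurent_norm (big_rem m) //= addn_gt0 absz_gt0 mcoeff_neq0 mf.
Qed.

Variable R : realType.
Implicit Types z w : 'rV[R[i]]_d.

Lemma coord_dist_le z w j : `|z 0 j - w 0 j| <= (torus_dist z w)%:C%C.
Proof.
rewrite -[leLHS]RRe_real ?normr_real // lecR.
have Re_ge0 k : 0 <= complex.Re `|z 0 k - w 0 k|.
  by rewrite -ler0c RRe_real ?normr_real.
rewrite -[leLHS]ger0_norm // -sqrtr_sqr ler_sqrt.
  by rewrite (bigD1 j) //= lerDl sumr_ge0 // => k _; rewrite sqr_ge0.
by rewrite sumr_ge0 // => k _; rewrite sqr_ge0.
Qed.

Lemma laurent_eval_lip f z w : torus z -> torus w ->
  `|laurent_eval f z - laurent_eval f w|
    <= (laurent_lip f)%:R * (torus_dist z w)%:C%C.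
Proof.
move=> z1 w1; rewrite /laurent_eval -sumrB natr_sum mulr_suml.
apply: le_trans (ler_norm_sum _ _ _) _; apply: ler_sum => m _.
rewrite -mulrBr normrM -intr_norm -natr_absz natrM -mulrA ler_wpM2l //.
rewrite natr_sum mulr_suml.
apply: le_trans (normr_prodB_le _ _ _) _ => [j|j|].
- exact: normr_exprz_unit.
- exact: normr_exprz_unit.
apply: ler_sum => j _; apply: le_trans (normr_exprzB_le _ (z1 j) (w1 j)) _.
by rewrite ler_wpM2l // coord_dist_le.
Qed.

(** [f(z)] is an eigenvalue of an integer matrix of size [n] whose column sums of absolute values
    are at most the l^1 norm of [f]. The root bound then applies to its characteristic polynomial,
    of degree [n]. *)
Lemma laurent_eval_ge f z n : (0 < n)%N -> (forall j, z 0 j ^+ n = 1) ->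
  laurent_eval f z != 0 ->
  1 <= (laurent_norm f)%:R ^+ n * `|laurent_eval f z|.
Proof.
move=> n0 zn fz0.
have [s] := closed_field_poly_normal ('X^n - 1 : {poly R[i]}).
rewrite -['X^n - 1]/('X^n - 1%:P) lead_coefXnsubC // scale1r => sE.
have szs : size s = n.
  by apply: succn_inj; rewrite -(size_prod_XsubC s id) -sE size_XnsubC.
have in_s x : (x \in s) = (x ^+ n == 1).
  by rewrite -root_prod_XsubC -sE rootE !hornerE subr_eq0.
have monoX m : monomial_eval z m ^+ n = 1.
  rewrite /monomial_eval -prodrXl big1 // => j _.
  by rewrite exprnP exprzAC -exprnP zn exp1rz.
have mul_s (i : 'I_n) m : s`_i * monomial_eval z m \in s.
  by rewrite in_s exprMn monoX mulr1 -in_s mem_nth ?szs.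
pose idx (i : 'I_n) m := index (s`_i * monomial_eval z m) s.
(* Column [i] expresses [f(z) s_i] as an integer combination of the roots of unity in [s], so the
   row [s] is an eigenvector for [f(z)]. *)
pose A : 'M[int]_n := \matrix_(t, i) \sum_(m <- msupp f)
  f@_m *+ (val t == idx i m).
have pick_t (V : nmodType) (i : 'I_n) m (h : nat -> V) :
    \sum_(t < n) h t *+ (val t == idx i m) = h (idx i m).
  have lt_n : (idx i m < n)%N.
    by rewrite -[X in (_ < X)%N]szs index_mem mul_s.
  rewrite (bigD1 (Ordinal lt_n)) //= eqxx big1 ?addr0 // => t.
  by rewrite -val_eqE /= => /negPf->.
have eigA : eigenvalue (map_mx intr A) (laurent_eval f z).
  apply/eigenvalueP; exists (\row_i s`_i).
    apply/rowP => i; rewrite !mxE mulr_suml.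
    under eq_bigr do rewrite !mxE rmorph_sum mulr_sumr /=.
    rewrite exchange_big; apply: eq_bigr => m _ /=.
    under eq_bigr do rewrite rmorphMn /= mulrnAr.
    rewrite (pick_t _ i m (fun t => s`_t * (f@_m)%:~R)) /idx nth_index //.
    by rewrite mulrC mulrA mulrAC.
  apply/rV0Pn; exists (Ordinal n0); rewrite mxE /=.
  have := mem_nth 0 (_ : 0 < size s)%N; rewrite szs => /(_ n0).
  rewrite in_s; apply: contraTneq => ->.
  by rewrite expr0n gtn_eqF // eq_sym oner_eq0.
have norm_ge1 : 1 <= (laurent_norm f)%:R :> R[i].
  rewrite ler1n laurent_norm_gt0 //; apply: contraNneq fz0 => ->.
  by rewrite /laurent_eval msupp0 big_seq_fset0.
have := @monic_int_root_ge _ (char_poly A) _ (laurent_eval f z)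
  (char_poly_monic A) norm_ge1.
rewrite size_char_poly map_char_poly -eigenvalue_root_char; apply => //.
move=> x; rewrite -eigenvalue_root_char; apply: eigenvalue_norm_le => i.
under eq_bigr do rewrite !mxE rmorph_sum.
apply: (@le_trans _ _ (\sum_(t < n) \sum_(m <- msupp f)
   (`|f@_m|%:R : R[i]) *+ (val t == idx i m))).
  apply: ler_sum => t _; apply: le_trans (ler_norm_sum _ _ _) _.
  apply: ler_sum => m _; rewrite rmorphMn normrMn /= ler_wMn2r //.
  by rewrite -intr_norm natr_absz.
(* In a given column, each exponent [m] contributes to exactly one row. *)
rewrite exchange_big /= natr_sum; apply: ler_sum => m _.
by rewrite (pick_t _ i m (fun=> `|f@_m|%:R)).
Qed.

End LaurentBounds.

(** * Finiteness of the annihilator and orders of its elements *)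

Lemma torsion_vectors_finite (F : closedFieldType) (d n : nat) : (0 < n)%N ->
  finite_set [set w : 'rV[F]_d | forall j, w 0 j ^+ n = 1].
Proof.
move=> n0; have [s] := closed_field_poly_normal ('X^n - 1%:P : {poly F}).
rewrite lead_coefXnsubC // scale1r => sE.
pose row_of (g : {ffun 'I_d -> seq_sub s}) : 'rV[F]_d := \row_j val (g j).
apply: (@sub_finite_set _ _ (row_of @` setT)); last first.
  exact/finite_image/finite_finset.
move=> w /= wn; have ws j : w 0 j \in s.
  by rewrite -root_prod_XsubC -sE rootE !hornerE wn subrr.
exists [ffun j => SeqSub (ws j)] => //.
by apply/rowP => j; rewrite !mxE ffunE.
Qed.

Section Annihilator.
Variables (R : realType) (d : nat) (G : zmodClosed 'rV[int]_d).
Hypothesis finG : finite_index G.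

Lemma finite_index_torsion (m : 'rV[int]_d) :
  exists2 k, (0 < k)%N & m *+ k \in G.
Proof.
have [k|i [j [ij _ uij]]] :=
  finite_set_pigeonhole (u := fun k => [set y | y - m *+ k \in G]) finG.
  by exists (m *+ k).
exists (j - i)%N; first by rewrite subn_gt0.
(* The cosets of [i m] and [j m] agree, so [j m - i m] lies in [G]. *)
have : [set y | y - m *+ j \in G] (m *+ j) by rewrite /= subrr rpred0.
by rewrite -uij /= mulrnBr // ltnW.
Qed.

(** Some positive multiple [k_j e_j] of each basis vector lies in [G]; the product of the [k_j]
    serves all coordinates. This crude exponent only yields finiteness; the bound by the cardinality
    comes from pigeonhole below. *)
Lemma annihilator_torsion : exists2 n, (0 < n)%N &
  forall w : 'rV[R[i]]_d, annihilator G w -> forall j, w 0 j ^+ n = 1.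
Proof.
pose e (j : 'I_d) : 'rV[int]_d := delta_mx 0 j.
have /choice[k kP] : forall j, exists k, (0 < k)%N /\ e j *+ k \in G.
  by move=> j; have [k] := finite_index_torsion (e j); exists k.
exists (\prod_j k j)%N; first by apply: prodn_gt0 => j; case: (kP j).
move=> w [_ wG] j; have [_ /wG] := kP j.
rewrite /monomial_eval (bigD1 j) //= big1 => [|i ij].
  rewrite !mulmxnE !mxE !eqxx mulr1 /= mulr1n natz -exprnP => wk.
  by rewrite (bigD1 j) //= exprM wk expr1n.
by rewrite mulmxnE mxE (negPf ij) andbF mul0rn expr0z.
Qed.

Lemma annihilator_finite : finite_set (annihilator G : set 'rV[R[i]]_d).
Proof.
have [n n0 wn] := annihilator_torsion.
by apply: sub_finite_set (@torsion_vectors_finite R[i] d n n0) => w; apply: wn.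
Qed.

Lemma annihilator_exp (w : 'rV[R[i]]_d) k :
  annihilator G w -> annihilator G (\row_j w 0 j ^+ k).
Proof.
move=> [w1 wG]; split=> [j|m mG]; first by rewrite mxE normrX w1 expr1n.
rewrite /monomial_eval.
under eq_bigr do rewrite mxE exprnP exprzAC -exprnP.
by rewrite prodrXl [X in X ^+ _](wG m mG) expr1n.
Qed.

(** Two of the powers [w^0, ..., w^N], with [N] the cardinality, coincide; cancelling the smaller
    power leaves an exponent at most [N]. *)
Lemma annihilator_order (w : 'rV[R[i]]_d) : annihilator G w ->
  exists n, [/\ (0 < n)%N, (n <= annihilator_card R G)%N &
                forall j, w 0 j ^+ n = 1].
Proof.
move=> wG.
have [i [k [ik kn /rowP uik]]] := finite_set_pigeonhole annihilator_finite
  (fun k => annihilator_exp k wG).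
exists (k - i)%N; split; first by rewrite subn_gt0.
  exact: leq_trans (leq_subr _ _) kn.
move=> j; have := uik j; rewrite !mxE.
rewrite -[k in RHS](subnKC (ltnW ik)) exprD => wik.
case: wG => /(_ j) w1 _.
have wi : w 0 j ^+ i != 0 by rewrite expf_neq0 // -normr_eq0 w1 oner_neq0.
by apply: (mulfI wi); rewrite mulr1 -wik.
Qed.

End Annihilator.

(** * From the lower bound on values to the distance estimate *)

Theorem theorem7p4 (R : realType) (d : nat) (d_ge1 : (1 <= d)%N)
    (f : laurent d) (f_neq0 : f != 0) (f_irr : irreducible f)
    (eps : R) (eps_gt0 : 0 < eps)
    (psi : nat -> nat) (psi_oo : psi n @[n --> \oo] --> \oo) :
  exists2 L : nat, (1 <= L)%N &
    forall G : zmodClosed 'rV[int]_d, finite_index G -> (L < min_norm G)%N ->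
    forall w : 'rV[R[i]]_d, (annihilator G `\` unitary_variety f) w ->
    ((expR (- (eps * (psi (min_norm G))%:R * (annihilator_card R G)%:R)))%:E
       <= dist_to w (unitary_variety f))%E.
Proof.
(* The successor keeps [C] positive even when the Lipschitz constant is 0. *)
pose C : nat := (laurent_norm f * (laurent_lip f).+1)%N.
have C_gt0 : (0 < C)%N by rewrite muln_gt0 laurent_norm_gt0.
(* Once [psi >= M + 1 > ln C / eps], one has [C <= exp(eps psi)]. *)
pose M := Num.Def.truncn (ln (C%:R : R) / eps).
have [L _ psiL] := (cvgnyPge psi).1 psi_oo M.+1.
exists L.+1 => // G finG ltL w [wG wU].
have [n [n_gt0 nG wn]] := annihilator_order finG wG.
set N := annihilator_card R G in nG *.
have fw0 : laurent_eval f w != 0.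
  by apply/eqP => fw0; apply: wU; split => //; case: wG.
(* It suffices to bound the distance to each zero [z]; an empty zero set is covered, its infimum
   being infinite. *)
apply/ereal_infP => _ [z [z1 fz0] <-]; rewrite lee_fin.
have C_le : C%:R <= expR (eps * (psi (min_norm G))%:R) :> R.
  rewrite -ler_ln ?posrE ?expR_gt0 ?ltr0n // expRK mulrC -ler_pdivrMr //.
  apply: le_trans (ltW (truncnS_gt _)) _.
  by rewrite ler_nat psiL //=; apply: ltnW; apply: ltnW.
have dist_ge : 1 <= C%:R ^+ N * torus_dist w z.
  rewrite -lecR rmorphM rmorphXn /= rmorph_nat rmorph1.
  apply: le_trans (laurent_eval_ge n_gt0 wn fw0) _.
  (* Since [f(z) = 0], the Lipschitz bound controls [|f(w)|] itself. *)
  have := laurent_eval_lip f (proj1 wG) z1; rewrite fz0 subr0 => fw_le.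
  apply: le_trans (ler_wpM2l (exprn_ge0 _ (ler0n _ _)) fw_le) _.
  rewrite mulrA -!natrX -natrM ler_wpM2r ?ler0c ?sqrtr_ge0 // ler_nat.
  (* The single Lipschitz factor is absorbed into its successor to the power [n], as [n > 0]. *)
  apply: leq_trans (leq_pexp2l C_gt0 nG); rewrite expnMn leq_mul2l.
  by rewrite (leq_trans (leqnSn _)) ?orbT // -[X in (X <= _)%N]expn1 leq_pexp2l.
rewrite expRN -[_^-1]mul1r ler_pdivrMr ?expR_gt0 // mulrC.
apply: le_trans dist_ge _; rewrite ler_wpM2r ?sqrtr_ge0 //.
by rewrite expRM_natr lerXn2r ?nnegrE ?expR_ge0.
Qed.
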